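(* Let $X$ and $Y$ be complete locally compact path-metric spaces, let $f \colon X \to Y$ be a continuous mapping and let $L \geq 1$. Then the following are equivalent: (i) $f$ is an $L$-BLD-mapping; (ii) $f$ is a discrete $L$-LQ-mapping; (iii) $f$ is an open $L$-radial mapping; (iv) $f$ is an $L$-coradial mapping.
   Context: A path is a continuous map defined on an interval (here $[0,1]$), and $\ell(\gamma)\in[0,\infty]$ denotes the length of a path $\gamma$. A metric space $(X,d)$ is a path-metric space if $d(x,y)=\inf\{\ell(\gamma) \mid \gamma\colon[0,1]\to X,\ \gamma(0)=x,\ \gamma(1)=y\}$ for all $x,y\in X$. $B_X(x,r)=B(x,r)$ denotes the open ball. A mapping is open if images of open sets are open, and discrete if every point inverse $f^{-1}(\{y\})$ is a discrete set. A branched cover is a continuous, discrete and open mapping. $f\colon X\to Y$ is $L$-BLD if it is a branched cover and $L^{-1}\ell(\gamma)\le \ell(f\circ\gamma)\le L\,\ell(\gamma)$ for all paths $\gamma\colon[0,1]\to X$ (rectifiable or not). $f$ is $L$-LQ (Lipschitz quotient) if for all $x\in X$ and $r>0$, $B_Y(f(x),L^{-1}r)\subset f(B_X(x,r))\subset B_Y(f(x),Lr)$. For $x\in X$, $r>0$ let $U(x,f,r)$ be the component of $f^{-1}(B_Y(f(x),r))$ containing $x$, and set $L(x,f,r)=\sup\{d(f(x),f(y)) \mid y\in\partial B(x,r)\}$, $l(x,f,r)=\inf\{d(f(x),f(y)) \mid y\in\partial B(x,r)\}$, $L^*(x,f,r)=\sup\{d(x,y)\mid y\in\partial U(x,f,r)\}$,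 $l^*(x,f,r)=\inf\{d(x,y)\mid y\in\partial U(x,f,r)\}$, where $\partial$ is topological boundary (conventions $\sup\emptyset=0$, $\inf\emptyset=+\infty$). $f$ is $L$-radial if for all $x\in X$ there is $r_0>0$ such that for all $0<r<r_0$: $L(x,f,r)\le Lr$ and $l(x,f,r)\ge L^{-1}r$. $f$ is $L$-coradial if it is a branched cover and for all $x\in X$ there is $r_0>0$ such that for all $0<r<r_0$: $L^*(x,f,r)\le Lr$ and $l^*(x,f,r)\ge L^{-1}r$. *)

(* Defs.v *)
From mathcomp Require Import all_boot all_order all_algebra.
From mathcomp Require Import all_classical all_reals all_analysis.

Set Implicit Arguments.
Unset Strict Implicit.
Unset Printing Implicit Defensive.

Import Order.TTheory GRing.Theory Num.Theory.

Local Open Scope classical_set_scope.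
Local Open Scope ring_scope.

(* Not [completeType], which would require T to be pointed, hence nonempty. *)
Definition complete_space (T : uniformType) :=
  forall F : set_system T, ProperFilter F -> cauchy F -> exists x : T, F --> x.

Section topology.
Context {X Y : topologicalType}.

Definition boundary (A : set X) : set X := closure A `\` interior A.

Definition discrete_set (A : set X) := A `<=` isolated A.

Definition discrete_map (f : X -> Y) :=
  forall y, discrete_set (f @^-1` [set y]).

Definition open_map (f : X -> Y) := forall A, open A -> open (f @` A).

Definition branched_cover (f : X -> Y) :=
  [/\ continuous f, discrete_map f & open_map f].

End topology.

Section length.
Context {R : realType} {X : metricType R}.
Implicit Types (a b : R) (g : R -> X).

(* The metric analogue of [variation] and [total_variation]: a :: s lists the
   points of a partition of [a, b]. *)
Definition polygonal_length a b g (s : seq R) : R :=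
  let G := g \o nth b (a :: s) in
  \sum_(0 <= i < size s) mdist (G i) (G i.+1).

Definition path_length a b g : \bar R :=
  ereal_sup [set (polygonal_length a b g s)%:E | s in itv_partition a b].

(* A path [0, 1] -> X is represented by a function on R whose values outside
   [0, 1] are irrelevant. *)
Definition is_path g := {within `[0, 1], continuous g}.

Definition length g : \bar R := path_length 0 1 g.

End length.

Definition path_metric_space {R : realType} (X : metricType R) :=
  forall x y : X, (mdist x y)%:E =
    ereal_inf [set length g | g in [set g | [/\ is_path g, g 0 = x & g 1 = y]]].

Section mappings.
Context {R : realType} {X Y : metricType R}.
Implicit Types (L r : R) (f : X -> Y) (x : X).

Definition BLD L f := branched_cover f /\
  forall g : R -> X, is_path g ->
    (L^-1%:E * length g <= length (f \o g) <= L%:E * length g)%E.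

Definition lipschitz_quotient L f := forall x r, 0 < r ->
  ball (f x) (L^-1 * r) `<=` f @` ball x r /\
  f @` ball x r `<=` ball (f x) (L * r).

Definition ball_component x f r : set X :=
  connected_component (f @^-1` ball (f x) r) x.

(* Suprema and infima of sets of distances, taken in [0, +oo]: [ereal_sup set0]
   is -oo, so the maximum with 0 gives sup set0 = 0 and changes no other
   supremum; [ereal_inf set0] is +oo. *)
Definition dist_sup (S : set R) : \bar R := maxe 0%E (ereal_sup (EFin @` S)).
Definition dist_inf (S : set R) : \bar R := ereal_inf (EFin @` S).

(* In the usual notation, the next four are L(x, f, r), l(x, f, r), L^*(x, f, r)
   and l^*(x, f, r), and [ball_component x f r] is U(x, f, r). *)
Definition outer_dilatation x f r :=
  dist_sup [set mdist (f x) (f y) | y in boundary (ball x r)].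

Definition inner_dilatation x f r :=
  dist_inf [set mdist (f x) (f y) | y in boundary (ball x r)].

Definition outer_codilatation x f r :=
  dist_sup [set mdist x y | y in boundary (ball_component x f r)].

Definition inner_codilatation x f r :=
  dist_inf [set mdist x y | y in boundary (ball_component x f r)].

Definition radial L f := forall x, exists2 r0 : R, 0 < r0 &
  forall r, 0 < r < r0 ->
    (outer_dilatation x f r <= (L * r)%:E)%E /\
    ((L^-1 * r)%:E <= inner_dilatation x f r)%E.

Definition coradial L f := branched_cover f /\
  forall x, exists2 r0 : R, 0 < r0 &
  forall r, 0 < r < r0 ->
    (outer_codilatation x f r <= (L * r)%:E)%E /\
    ((L^-1 * r)%:E <= inner_codilatation x f r)%E.

End mappings.

(* Main.v *)
(* The equivalence goes around the cycle (i) => (ii) => (iii) => (iv) => (i);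
   apart from (i) => (ii), every step passes through the pointwise estimate
   [d(x, y) / L <= d(f x, f y) <= L d(x, y)] for [y] near [x]
   ([locally_radial]).
   - (i) => (ii). Short paths starting at [f x] lift through the discrete open
     map [f]: grid lifts exist by uniform openness, and a limit along an
     ultrafilter is continuous since [f^-1 (f a)] is isolated at [a]. Hence
     [f] covers small balls around [f x] with the constant [L], and Ekeland's
     variational principle on the complete space [X] makes this global.
   - (iii) => (iv). The connected set [U(x, f, r)] cannot meet a sphere of
     radius larger than [L r], and [f] maps its boundary to the sphere of radius
     [r] around [f x].
   - (iv) => (i). For [y] near [x], the component of [f^-1 B(f x, r)] around a
     point near [x] is mapped onto [B(f x, r)], so it contains [x]; thus [y] is
     in the boundary of [U(x, f, d(f x, f y))]. The pointwise estimate gives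
     the length bounds by Cousin's lemma. *)

Require Import Defs.
From mathcomp Require Import all_boot all_order all_algebra.
From mathcomp Require Import all_classical all_reals all_analysis.
From mathcomp Require Import lra.

Set Implicit Arguments.
Unset Strict Implicit.
Unset Printing Implicit Defensive.

Import Order.TTheory GRing.Theory Num.Theory.
Import numFieldNormedType.Exports.
Local Open Scope classical_set_scope.
Local Open Scope ring_scope.

(** * Metric topology *)

Section metric_topology.
Context {R : realType}.

Lemma mball {T : metricType R} (x y : T) (e : R) :
  ball x e y = (mdist x y < e) :> Prop.
Proof. by rewrite ballEmdist. Qed.

Lemma nbhs_mdist {T : metricType R} (x : T) (P : set T) :
  nbhs x P <-> exists2 e : R, 0 < e & forall y, mdist x y < e -> P y.
Proof.
split=> [/nbhs_ballP[e /= e0 eP]|[e e0 eP]].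
  by exists e => // y xy; apply: eP; rewrite mball.
by apply/nbhs_ballP; exists e => //= y; rewrite mball; exact: eP.
Qed.

Lemma open_mdist {T : metricType R} (A : set T) :
  open A <-> forall x, A x ->
    exists2 e : R, 0 < e & forall y, mdist x y < e -> A y.
Proof.
rewrite openE; split=> [Ao x /Ao/nbhs_mdist//|Ao x Ax].
exact/nbhs_mdist/Ao.
Qed.

Lemma open_mball {T : metricType R} (x : T) (r : R) : open (ball x r).
Proof.
apply/open_mdist => y; rewrite mball => xy.
exists (r - mdist x y) => [|z yz]; first by rewrite subr_gt0.
by rewrite mball; have := metric_triangle x y z; lra.
Qed.

Lemma closed_mdist_le {T : metricType R} (x : T) (r : R) :
  closed [set y | mdist x y <= r].
Proof.
rewrite -openC; apply/open_mdist => y /negP; rewrite -ltNge => xy.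
exists (mdist x y - r) => [|z yz]; first by rewrite subr_gt0.
apply/negP; rewrite -ltNge; have := metric_triangle x z y.
by rewrite (metric_sym z y); lra.
Qed.

Lemma closure_mdist {T : metricType R} (A : set T) (x : T) :
  closure A x <->
  forall e : R, 0 < e -> exists2 y, A y & mdist x y < e.
Proof.
split=> [clA e e0|clA B /nbhs_mdist[e e0 eB]].
  have /clA[y [Ay xy]] : nbhs x [set y | mdist x y < e].
    by apply/nbhs_mdist; exists e.
  by exists y.
by have [y Ay xy] := clA e e0; exists y; split=> //; exact: eB.
Qed.

Lemma continuous_mdist {T U : metricType R} (f : T -> U) : continuous f ->
  forall x (e : R), 0 < e -> exists2 d : R, 0 < d &
    forall y, mdist x y < d -> mdist (f x) (f y) < e.
Proof.
move=> cf x e e0.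
have : nbhs (f x) [set y | mdist (f x) y < e] by apply/nbhs_mdist; exists e.
by move=> /cf /nbhs_mdist.
Qed.

Lemma path_mdist {T : metricType R} (g : R -> T) :
  is_path g <-> forall t, 0 <= t <= 1 -> forall e, 0 < e ->
    exists2 d : R, 0 < d & forall s, 0 <= s <= 1 -> `|t - s| < d ->
      mdist (g t) (g s) < e.
Proof.
split=> [/subspace_continuousP cg t t01 e e0|cg].
  have gt : nbhs (g t) [set y | mdist (g t) y < e].
    by apply/nbhs_mdist; exists e.
  have /cg/(_ _ gt) : `[0, 1]%classic t by rewrite /= in_itv.
  move=> /(nbhs_ballP _ _).1 [d /= d0 dP].
  exists d => // s s01 ts; apply: (dP s) => //; rewrite ?in_itv//.
apply/subspace_continuousP => t /=; rewrite in_itv/= => t01.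
move=> B /nbhs_mdist[e e0 eB]; have [d d0 dP] := cg t t01 e e0.
suff : nbhs t [set s | `[0, 1]%classic s -> B (g s)] by [].
apply/nbhs_ballP; exists d => //= s ts.
by move=> s01; apply/eB/dP; rewrite // -in_itv.
Qed.

Lemma discrete_mdist {T U : metricType R} {f : T -> U} : discrete_map f ->
  forall x, exists2 e : R, 0 < e &
    forall y, mdist x y < e -> f y = f x -> y = x.
Proof.
move=> df x; have [|_ [V /nbhs_mdist[e e0 eV] VE]] := df (f x) x => //.
exists e => // y xy fyx; suff : (V `&` f @^-1` [set f x]) y by rewrite VE.
by split=> //; exact: eV.
Qed.

Lemma mdist_discrete {T U : metricType R} {f : T -> U} :
  (forall x, exists2 e : R, 0 < e &
    forall y, mdist x y < e -> f y = f x -> y = x) -> discrete_map f.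
Proof.
move=> H y x /= fxy; split; first by rewrite inE.
have [e e0 eP] := H x; exists [set z | mdist x z < e].
  by apply/nbhs_mdist; exists e.
apply/seteqP; split=> [z /= [xz fz]|z ->] /=.
  by apply: eP => //; rewrite fz.
by rewrite mdistxx.
Qed.

Lemma locally_compact_mdist {T : metricType R} :
  locally_compact [set: T] ->
  forall x : T, exists2 e : R, 0 < e & compact [set y | mdist x y <= e].
Proof.
move=> lcT x; have [B /= xB [cB clB]] := lcT x I.
have /nbhs_mdist[e e0 eB] : nbhs x [set y | setT y -> B y] by [].
exists (e / 2); first by rewrite divr_gt0.
apply: (subclosed_compact _ cB); first exact: closed_mdist_le.
by move=> y /= xy; apply: eB => //; lra.
Qed.

(** As [A] avoids the sphere of radius [r], the open and the closed ball have the same trace on [A];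
    this trace is nonempty and clopen in [A], hence all of [A]. *)
Lemma connected_sub_ball {T : metricType R} (A : set T) (x a : T) (r : R) :
  connected A -> A a -> mdist x a < r -> (forall y, A y -> mdist x y <> r) ->
  A `<=` ball x r.
Proof.
move=> cA Aa xa Ar; suff : A `&` ball x r = A by move=> /setIidPl.
apply: cA.
- by exists a; split=> //; rewrite mball.
- by exists (ball x r) => //; exact: open_mball.
- exists [set y | mdist x y <= r]; first exact: closed_mdist_le.
  apply/seteqP; split=> y /=; rewrite mball => -[Ay xy]; split=> //.
    exact: ltW.
  by rewrite lt_neqAle xy andbT; apply/eqP/Ar.
Qed.

(** The near-covering form of compactness is applied with the parameter tending to [0] from the
    right; monotonicity of [P] lets each local constant shrink. *)
Lemma compact_uniform {T : topologicalType} (K : set T) (P : R -> T -> Prop) :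
  compact K ->
  (forall (e d : R) x, 0 < d -> d <= e -> P e x -> P d x) ->
  (forall x, K x -> exists2 e : R, 0 < e &
     \forall y \near x, K y -> P e y) ->
  exists2 e : R, 0 < e & forall x, K x -> P e x.
Proof.
move=> /compact_near_coveringP/near_covering_withinP cK Pmono locP.
suff H : \forall e \near (0 : R)^'+, K `<=` P e.
  near (0 : R)^'+ => e.
  by exists e => [//|]; near: e.
apply: cK => x /locP[e e0 Pe].
near=> y d => Ky /=; apply: (Pmono e) => //.
  by near: d; exact: nbhs_right_le.
by move: Ky => /=; near: y.
Unshelve. all: by end_near. Qed.

End metric_topology.

(** * Lengths and path-metric spaces *)

Section path_length.
Context {R : realType}.

(* Cousin's lemma: the supremum of the points reached from [a] is reached, and
   it is [b]. *)
Lemma itv_cousin (P : R -> R -> Prop) (a b : R) :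
  (forall u v w, u < v -> v < w -> P u v -> P v w -> P u w) ->
  (forall t, a <= t <= b -> exists2 d : R, 0 < d & forall s, a <= s <= b ->
     `|t - s| < d -> (s < t -> P s t) /\ (t < s -> P t s)) ->
  a < b -> P a b.
Proof.
move=> Ptrans Ploc ab.
pose S := [set t | a <= t <= b /\ (t = a \/ (a < t /\ P a t))].
have Sstep t s : S t -> t < s -> s <= b -> P t s -> S s.
  move=> [/andP[at_ tb] tP] ts sb Pts; have as_ : a < s by lra.
  split; first by rewrite sb ltW.
  by right; split=> //; case: tP => [<-//|[at' /Ptrans]]; exact.
have Sa : S a by split; [rewrite lexx ltW|left].
have supS : has_sup S by split; [exists a|exists b => t [/andP[]]].
have leS := sup_upper_bound supS.
have am : a <= sup S by exact: leS.
have mb : sup S <= b by apply: ge_sup => [|t [/andP[]]//]; exists a.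
have [|d d0 dP] := Ploc (sup S); first by rewrite am.
have Sm : S (sup S).
  have [t St tm] := sup_adherent d0 supS.
  have := leS _ St; rewrite le_eqVlt => /predU1P[<-//|tlt].
  apply: (Sstep t) => //; have [||+ _] := dP t; last exact.
    by case: St.
  by rewrite ger0_norm; lra.
have : sup S = b.
  apply/eqP; rewrite eq_le mb leNgt; apply/negP => mb'.
  pose s := Num.min b (sup S + d / 2).
  have [ms sb sd] : [/\ sup S < s, s <= b & s <= sup S + d / 2].
    by rewrite /s lt_min ge_min lexx ge_min lexx orbT mb'; split=> //; lra.
  have /leS : S s; last by rewrite leNgt ms.
  apply: (Sstep (sup S)) => //; have [||_] := dP s; last exact.
    by rewrite sb andbT; lra.
  by rewrite ler0_norm; lra.
by move=> mE; move: Sm; rewrite mE => -[_ [ba|[]//]]; move: ab; rewrite ba ltxx.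
Qed.

Lemma polygonal_length_cons {T : metricType R} (a b c : R) (g : R -> T) s :
  polygonal_length a b g (c :: s) =
  mdist (g a) (g c) + polygonal_length c b g s.
Proof. by rewrite /polygonal_length big_nat_recl. Qed.

Lemma polygonal_length_nil {T : metricType R} (a b : R) (g : R -> T) :
  polygonal_length a b g [::] = 0.
Proof. by rewrite /polygonal_length big_geq. Qed.

Lemma polygonal_length_cat {T : metricType R} (a b c : R) (g : R -> T) s t :
  itv_partition a b s ->
  polygonal_length a c g (s ++ t) =
  polygonal_length a b g s + polygonal_length b c g t.
Proof.
elim: s a => [a /itv_partition_nil -> /=|x s ih a /itv_partition_cons ps].
  by rewrite polygonal_length_nil add0r.
by rewrite /= !polygonal_length_cons ih// addrA.
Qed.

Section comparison.
Context {T U : metricType R} (h : R -> T) (g : R -> U) (a b L : R).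
Hypothesis L_ge0 : 0 <= L.
Hypothesis hg : forall t, a <= t <= b -> exists2 d : R, 0 < d &
  forall s, a <= s <= b -> `|t - s| < d ->
    mdist (h t) (h s) <= L * mdist (g t) (g s).

(** Existence of such a partition is transitive in [(u, v)], by concatenation, and holds locally
    with a single segment, by [hg]; so [itv_cousin] applies. *)
Lemma mdist_le_polygonal_length (u v : R) : a <= u -> u < v -> v <= b ->
  exists2 s, itv_partition u v s &
    mdist (h u) (h v) <= L * polygonal_length u v g s.
Proof.
move=> au uv vb.
apply: (@itv_cousin (fun u v => exists2 s, itv_partition u v s &
    mdist (h u) (h v) <= L * polygonal_length u v g s)) => //.
- move=> x y z xy yz [s ps hs] [t pt ht]; exists (s ++ t).
    exact: itv_partition_cat ps pt.
  rewrite (polygonal_length_cat _ _ _ ps) mulrDr.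
  by rewrite (le_trans (metric_triangle _ (h y) _))// lerD.
- move=> t /andP[ut tv]; have [|d d0 dP] := @hg t.
    by rewrite (le_trans au)// (le_trans tv).
  exists d => // s /andP[us sv] ts.
  have hts : mdist (h t) (h s) <= L * mdist (g t) (g s).
    by apply: dP => //; rewrite (le_trans au)// (le_trans sv).
  split=> st.
    exists [:: t]; first exact: itv_partition1.
    rewrite polygonal_length_cons polygonal_length_nil addr0.
    by rewrite metric_sym (metric_sym (g s)).
  exists [:: s]; first exact: itv_partition1.
  by rewrite polygonal_length_cons polygonal_length_nil addr0.
Qed.

(** Every segment of a partition used for [h] is subdivided by [mdist_le_polygonal_length], and the
    estimates add up. *)
Lemma path_length_le : (path_length a b h <= L%:E * path_length a b g)%E.
Proof.
apply: ge_ereal_sup => _ [s ps <-].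
suff [s' ps' ss'] : exists2 s', itv_partition a b s' &
    polygonal_length a b h s <= L * polygonal_length a b g s'.
  apply: (@le_trans _ _ (L%:E * (polygonal_length a b g s')%:E)%E).
    by rewrite -EFinM lee_fin.
  by apply: lee_wpmul2l; [rewrite lee_fin|apply: ereal_sup_ubound; exists s'].
suff H u : a <= u -> itv_partition u b s -> exists2 s', itv_partition u b s' &
    polygonal_length u b h s <= L * polygonal_length u b g s' by exact: H.
elim: s u {ps} => [|v s ih] u au ps.
  by exists [::] => //; rewrite !polygonal_length_nil mulr0.
have uv : u < v by case: ps => /= /andP[].
have ps' := itv_partition_cons ps.
have [s1 ps1 hs1] := mdist_le_polygonal_length au uv (itv_partition_le ps').
have [s2 ps2 hs2] := ih v (le_trans au (ltW uv)) ps'.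
exists (s1 ++ s2); first exact: itv_partition_cat ps1 ps2.
by rewrite (polygonal_length_cat _ _ _ ps1) polygonal_length_cons mulrDr lerD.
Qed.

End comparison.

Section length.
Context {T : metricType R}.

Lemma length_split (g : R -> T) t : 0 <= t <= 1 ->
  ((mdist (g 0) (g t) + mdist (g t) (g 1))%:E <= length g)%E.
Proof.
(* Partitions are strictly increasing, so [t = 0] and [t = 1] are handled apart, with the
   one-segment partition. *)
move=> /andP[]; rewrite le_eqVlt => /predU1P[<- _|t0].
  rewrite mdistxx add0r; apply: ereal_sup_ubound; exists [:: 1].
    exact: itv_partition1.
  by rewrite polygonal_length_cons polygonal_length_nil addr0.
rewrite le_eqVlt => /predU1P[->|t1].
  rewrite mdistxx addr0; apply: ereal_sup_ubound; exists [:: 1].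
    exact: itv_partition1.
  by rewrite polygonal_length_cons polygonal_length_nil addr0.
apply: ereal_sup_ubound; exists [:: t; 1].
  by split => //=; rewrite t0 t1.
by rewrite !polygonal_length_cons polygonal_length_nil addr0.
Qed.

Lemma mdist_le_length (g : R -> T) : ((mdist (g 0%R) (g 1%R))%:E <= length g)%E.
Proof.
by have := @length_split g 1; rewrite mdistxx addr0 lexx ler01; exact.
Qed.

Lemma eq_length (g h : R -> T) : (forall t, 0 <= t <= 1 -> g t = h t) ->
  length g = length h.
Proof.
have le_len (g' h' : R -> T) : (forall t, 0 <= t <= 1 -> g' t = h' t) ->
    (length g' <= length h')%E.
  move=> gh; rewrite -[leRHS]mul1e; apply: path_length_le => // t t01.
  by exists 1 => // s s01 _; rewrite !gh// mul1r.
by move=> gh; apply/eqP; rewrite eq_le !le_len// => t /gh.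
Qed.

Hypothesis path_metricT : path_metric_space T.

Lemma path_metric_path (x y : T) (r : R) : mdist x y < r ->
  exists g : R -> T, [/\ is_path g, g 0 = x, g 1 = y & (length g < r%:E)%E].
Proof.
rewrite -lte_fin path_metricT => /ereal_inf_lt[_ [g [gc g0 g1] <-] gr].
by exists g.
Qed.

(** The intermediate value theorem is applied to the distance from [x] along a path of length less
    than [mdist x y + e]; what remains of this length bounds the distance from [z] to [y]. *)
Lemma path_metric_between (x y : T) (s e : R) :
  0 <= s <= mdist x y -> 0 < e ->
  exists2 z, mdist x z = s & mdist z y < mdist x y - s + e.
Proof.
move=> /andP[s0 sxy] e0.
have [|g [/path_mdist gc g0 g1 gl]] := @path_metric_path x y (mdist x y + e).
  by lra.
pose h (t : R) : R := mdist x (g t).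
have dgc : {within `[0, 1], continuous h}.
  apply/subspace_continuousP => t /=; rewrite in_itv/= => t01.
  move=> B /nbhs_ballP[d /= d0 dB]; have [c c0 cP] := gc t t01 d d0.
  suff : nbhs t [set s | `[0, 1]%classic s -> B (h s)] by [].
  apply/nbhs_ballP; exists c => //= r tr r01; apply: dB => /=.
  have {}cP : mdist (g t) (g r) < d by apply: cP; rewrite // -in_itv.
  have := metric_triangle x (g t) (g r); have := metric_triangle x (g r) (g t).
  rewrite (metric_sym (g r)) /ball/= /h => h1 h2.
  suff : `|mdist x (g t) - mdist x (g r)| < d by [].
  by rewrite ltr_norml; apply/andP; split; lra.
have [||t] := @IVT _ _ 0 1 s _ dgc.
- exact: ler01.
- by rewrite /h g0 g1 mdistxx ge_min s0 le_max sxy orbT.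
rewrite in_itv/= /h => t01 gt; exists (g t) => //.
have := le_lt_trans (length_split g t01) gl.
by rewrite lte_fin g0 g1; lra.
Qed.

(** In a general metric space the boundary may be smaller than the sphere. Here every point of the
    sphere has points nearby that are strictly closer to [x], by [path_metric_between]. *)
Lemma boundary_ball (x y : T) (r : R) : 0 < r ->
  boundary (ball x r) y <-> mdist x y = r.
Proof.
move=> r0; split=> [[]|xy].
  move=> /closure_mdist cly; rewrite (interior_id _).1; last exact: open_mball.
  rewrite mball => /negP; rewrite -leNgt => rxy.
  apply/eqP; rewrite eq_le rxy andbT; apply/ler_addgt0Pl => e e0.
  have [z] := cly e e0; rewrite mball => xz yz.
  by have := metric_triangle x z y; rewrite (metric_sym z y); lra.
split.
  apply/closure_mdist => e e0; pose s := Num.min (e / 2) r.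
  have [s0 se sr] : [/\ 0 < s, s <= e / 2 & s <= r].
    by rewrite /s lt_min !ge_min !lexx r0 orbT; split=> //; lra.
  have s2 : 0 < s / 2 by lra.
  have [|z yz zx] := @path_metric_between y x s _ _ s2.
    by rewrite (metric_sym y) xy (ltW s0).
  exists z; last by lra.
  by rewrite mball (metric_sym x); rewrite (metric_sym y) xy in zx; lra.
by move=> /interior_subset; rewrite mball xy ltxx.
Qed.

Lemma ball_connected (x : T) (r : R) : connected (ball x r).
Proof.
have [r0|r0] := ltP 0 r; last first.
  rewrite (_ : ball x r = set0); first exact: connected0.
  rewrite -subset0 => y; rewrite mball => xy.
  by have := mdist_ge0 x y; rewrite leNgt (lt_le_trans xy r0).
suff -> : ball x r = connected_component (ball x r) x.
  exact: component_connected.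
apply/seteqP; split; last exact: connected_component_sub.
move=> y; rewrite mball => /path_metric_path[g [gc g0 g1 gl]].
exists (g @` `[0, 1]); last by exists 1 => //=; rewrite in_itv/= ler01 lexx.
split.
- by exists 0 => //=; rewrite in_itv/= ler01 lexx.
- move=> z [t /=]; rewrite in_itv/= => t01 <-; rewrite mball.
  have := le_lt_trans (length_split g t01) gl.
  by rewrite lte_fin g0; apply: le_lt_trans; rewrite lerDl mdist_ge0.
- by apply: connected_continuous_connected gc; exact: segment_connected.
Qed.

(** A small ball around [y] lies in [A], is connected and meets the component. *)
Lemma closure_component (A : set T) (x y : T) :
  open A -> A y -> closure (connected_component A x) y ->
  connected_component A x y.
Proof.
move=> /open_mdist oA Ay /closure_mdist cly; have [e e0 eA] := oA y Ay.
have [z Az yz] := cly e e0; apply: connected_component_trans Az _.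
apply: connected_component_sym; exists (ball y e); last by rewrite mball.
split=> [|w|]; last exact: ball_connected.
  by rewrite mball mdistxx.
by rewrite mball; exact: eA.
Qed.

Lemma open_component (A : set T) (x : T) :
  open A -> open (connected_component A x).
Proof.
move=> /open_mdist oA; apply/open_mdist => y Ay.
have [e e0 eA] := oA y (connected_component_sub Ay); exists e => // z yz.
apply: connected_component_trans Ay _; exists (ball y e); last by rewrite mball.
split=> [|w|]; last exact: ball_connected.
  by rewrite mball mdistxx.
by rewrite mball; exact: eA.
Qed.

End length.
End path_length.

(** * Radial mappings *)

Section dilatation.
Context {R : realType}.

Lemma dist_sup_le (S : set R) (c : R) : 0 <= c ->
  (dist_sup S <= c%:E)%E <-> forall s, S s -> s <= c.
Proof.
move=> c0; split=> [Sc s Ss|Sc].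
  rewrite -lee_fin; apply: le_trans Sc.
  by rewrite /dist_sup le_max ereal_sup_ubound ?orbT//; exists s.
rewrite /dist_sup ge_max lee_fin c0/=; apply: ge_ereal_sup => _ [s Ss <-].
by rewrite lee_fin; exact: Sc.
Qed.

Lemma le_dist_inf (S : set R) (c : R) :
  (c%:E <= dist_inf S)%E <-> forall s, S s -> c <= s.
Proof.
split=> [Sc s Ss|Sc].
  by rewrite -lee_fin (le_trans Sc)//; apply: ereal_inf_lbound; exists s.
by apply: le_ereal_inf_tmp => _ [s Ss <-]; rewrite lee_fin; exact: Sc.
Qed.

Context {X Y : metricType R} (f : X -> Y) (L : R).
Hypothesis L_ge1 : 1 <= L.
Hypothesis continuous_f : continuous f.
Hypothesis path_metricX : path_metric_space X.

Let L_gt0 : 0 < L. Proof. exact: lt_le_trans L_ge1. Qed.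

Definition locally_radial (x : X) := exists2 e : R, 0 < e & forall y,
  mdist x y < e ->
  mdist x y <= L * mdist (f x) (f y) /\ mdist (f x) (f y) <= L * mdist x y.

Lemma lipschitz_quotient_open : lipschitz_quotient L f -> open_map f.
Proof.
move=> lqf A /open_mdist oA; apply/open_mdist => _ [x Ax <-].
have [e e0 eA] := oA x Ax; have [+ _] := lqf x e e0.
exists (L^-1 * e) => [|z xz]; first by rewrite mulr_gt0// invr_gt0.
have /(_ z)[|y] := a; first by rewrite mball.
by rewrite mball => /eA Ay <-; exists y.
Qed.

Lemma lipschitz_quotient_radial :
  discrete_map f -> lipschitz_quotient L f -> radial L f.
Proof.
move=> df lqf x; have [e e0 eP] := discrete_mdist df x.
exists (e / 2); first by rewrite divr_gt0.
move=> r /andP[r0 re]; split.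
  apply/dist_sup_le; first by rewrite mulr_ge0 ?ltW.
  move=> _ [y /(boundary_ball path_metricX _ _ r0) xy <-].
  apply/ler_addgt0Pl => d d0.
  (* The point [y] lies on the sphere, outside the open ball of radius [r]; enlarging the radius by
     [d / L] captures it and costs only [d] in the image. *)
  have dL : 0 < d / L by rewrite divr_gt0.
  have [_ /(_ (f y))] := lqf x (d / L + r) (addr_gt0 dL r0).
  rewrite mball mulrDr (mulrC L (d / L)) divfK ?gt_eqF// => H; apply/ltW/H.
  by exists y => //; rewrite mball; lra.
apply/le_dist_inf => _ [y /(boundary_ball path_metricX _ _ r0) xy <-].
(* If [f y] were too close to [f x], then [ball y r] would contain a preimage [x'] of [f x]. It is
   within [r + r < e] of [x], so it equals [x], against [mdist x y = r]. *)
rewrite leNgt; apply/negP => fxy.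
have [/(_ (f x)) + _] := lqf y r r0.
rewrite mball metric_sym => /(_ fxy)[x']; rewrite mball => yx' fx'.
have x'x : x' = x.
  by apply: eP => //; have := metric_triangle x y x'; lra.
by move: yx'; rewrite x'x metric_sym xy ltxx.
Qed.

Lemma radial_locally_radial : radial L f -> forall x, locally_radial x.
Proof.
move=> rf x; have [e e0 eP] := rf x; exists e => // y xy.
have := mdist_ge0 x y; rewrite le_eqVlt => /predU1P[/esym xy0|r0].
  by rewrite (mdist_positivity _ _ xy0) !mdistxx mulr0.
have [|/dist_sup_le H1 /le_dist_inf H2] := eP (mdist x y); first by rewrite r0.
have by_ : boundary (ball x (mdist x y)) y by exact/boundary_ball.
split.
  by rewrite -ler_pdivrMl//; apply: H2; exists y.
by apply: H1; [rewrite mulr_ge0 ?ltW|exists y].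
Qed.

Lemma locally_radial_discrete :
  (forall x, locally_radial x) -> discrete_map f.
Proof.
move=> rf; apply: mdist_discrete => x; have [e e0 eP] := rf x.
exists e => // y /eP[+ _] fyx; rewrite fyx mdistxx mulr0 => xy0.
by apply/esym/mdist_positivity/eqP; rewrite eq_le xy0 mdist_ge0.
Qed.

(** The component is open, and closed relative to the preimage of the ball, so its boundary points
    lie outside that preimage; continuity gives the other inequality. *)
Lemma boundary_ball_component (x y : X) (r : R) :
  boundary (ball_component x f r) y -> mdist (f x) (f y) = r.
Proof.
have oB : open (f @^-1` ball (f x) r).
  by apply: open_comp => [z _|]; [exact: continuous_f|exact: open_mball].
move=> [cly]; rewrite (interior_id _).1; last exact: open_component.
move=> nUy; apply/eqP; rewrite eq_le; apply/andP; split.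
  apply/ler_addgt0Pl => e e0.
  have [d d0 dP] := continuous_mdist continuous_f y e0.
  have [z /connected_component_sub + yz] := (closure_mdist _ _).1 cly d d0.
  rewrite /preimage/= mball => xz; have := dP z yz.
  by have := metric_triangle (f x) (f z) (f y); rewrite (metric_sym (f z)); lra.
rewrite leNgt; apply/negP => xy; apply: nUy.
by apply: closure_component => //; rewrite /preimage/= mball.
Qed.

Lemma locally_radial_coradial : open_map f ->
  (forall x, locally_radial x) -> coradial L f.
Proof.
move=> of_ rf; split.
  by split=> //; exact: locally_radial_discrete.
move=> x; have [e e0 eP] := rf x.
(* This bound gives [L * r < e], which leaves room for spheres of radius between [L * r] and [e];
   the estimate [eP] keeps the component off them. *)
exists (e / L); first by rewrite divr_gt0.
move=> r /andP[r0]; rewrite ltr_pdivlMr// mulrC => re.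
have U_sub s : L * r < s -> s < e -> ball_component x f r `<=` ball x s.
  move=> rs se; have s0 : 0 < s by rewrite (le_lt_trans _ rs)// mulr_ge0 ?ltW.
  apply: (@connected_sub_ball _ _ _ x x); first exact: component_connected.
  - by apply: connected_component_refl; rewrite /preimage/= mball mdistxx.
  - by rewrite mdistxx.
  move=> y /connected_component_sub; rewrite /preimage/= mball => xy xys.
  have [|+ _] := eP y; first by rewrite xys.
  by rewrite leNgt xys (lt_trans _ rs)// ltr_pM2l.
have bU y : boundary (ball_component x f r) y -> mdist x y <= L * r.
  move=> [/closure_mdist cly _]; apply/ler_addgt0Pl => d d0.
  pose s := Num.min (d / 2 + L * r) ((e + L * r) / 2).
  have [s1 s2 s3] : [/\ L * r < s, s <= d / 2 + L * r & s <= (e + L * r) / 2].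
    by rewrite /s lt_min !ge_min !lexx orbT; split=> //; apply/andP; split; lra.
  have d2 : 0 < d / 2 by lra.
  have [z /(U_sub s s1) + yz] := cly _ d2.
  rewrite mball => xz; have := metric_triangle x z y; rewrite (metric_sym z).
  by have := xz ltac:(lra); lra.
split.
  apply/dist_sup_le; first by rewrite mulr_ge0 ?ltW.
  by move=> _ [y /bU xy <-].
apply/le_dist_inf => _ [y yU <-]; have xy := bU y yU.
have [|_] := eP y; first exact: le_lt_trans xy re.
by rewrite (boundary_ball_component yU) ler_pdivrMl.
Qed.

Lemma locally_radial_BLD : branched_cover f ->
  (forall x, locally_radial x) -> BLD L f.
Proof.
move=> bf rf; split=> // g /path_mdist gc.
have near_g t : 0 <= t <= 1 -> exists2 d : R, 0 < d & forall s, 0 <= s <= 1 ->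
    `|t - s| < d -> mdist (g t) (g s) <= L * mdist (f (g t)) (f (g s)) /\
    mdist (f (g t)) (f (g s)) <= L * mdist (g t) (g s).
  move=> t01; have [e e0 eP] := rf (g t); have [d d0 dP] := gc t t01 e e0.
  by exists d => // s s01 ts; apply/eP/dP.
apply/andP; split.
  (* Both length bounds are instances of [path_length_le], with the roles of [g] and [f \o g]
     exchanged. *)
  rewrite lee_pdivrMl//; apply: path_length_le; first exact: ltW.
  move=> t /near_g[d d0 dP]; exists d => // s s01 ts.
  by have [] := dP s s01 ts.
apply: path_length_le; first exact: ltW.
move=> t /near_g[d d0 dP]; exists d => // s s01 ts.
by have [] := dP s s01 ts.
Qed.

End dilatation.

(** * Discrete open mappings *)

Section discrete_open.
Context {R : realType} {X Y : metricType R} (f : X -> Y).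
Hypothesis continuous_f : continuous f.
Hypothesis locally_compactX : locally_compact [set: X].

(** On a small compact ball only [x] is sent to [f x]; on the annulus the distance to [f x] is
    therefore positive, and compactness gives the lower bound [d]. *)
Lemma discrete_annulus (x : X) (e : R) : discrete_map f -> 0 < e ->
  exists s d : R, [/\ 0 < s <= e, 0 < d, compact [set y | mdist x y <= s],
    forall y, mdist x y <= s -> f y = f x -> y = x &
    forall y, s / 2 <= mdist x y <= s -> d <= mdist (f x) (f y)].
Proof.
move=> df e0; have [e1 e10 e1P] := discrete_mdist df x.
have [e2 e20 cK] := locally_compact_mdist locally_compactX x.
pose s := Num.min e (Num.min (e1 / 2) e2).
have [s0 se se1 se2] : [/\ 0 < s, s <= e, s <= e1 / 2 & s <= e2].
  rewrite /s !lt_min !ge_min !lexx !orbT; split=> //; apply/and3P; split=> //.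
  by rewrite divr_gt0.
have cs : compact [set y | mdist x y <= s].
  apply: (subclosed_compact _ cK); first exact: closed_mdist_le.
  by move=> y /=; lra.
have sP y : mdist x y <= s -> f y = f x -> y = x.
  by move=> xy; apply: e1P; lra.
have [|y xy|d d0 dP] := @compact_uniform _ _ _
    (fun d y => s / 2 <= mdist x y -> d <= mdist (f x) (f y)) cs.
- by move=> c d y d0 dc H /H; exact: le_trans.
- have [fxy|fxy] := eqVneq (f x) (f y).
    (* Here [y = x], and the premise [s / 2 <= mdist x z] fails near [x], so any constant works. *)
    exists 1 => //; apply/nbhs_mdist; exists (s / 2); first by rewrite divr_gt0.
    by move=> z; rewrite (sP y)// => xz _; lra.
  have D0 : 0 < mdist (f x) (f y) / 2 by rewrite divr_gt0// mdist_gt0.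
  exists (mdist (f x) (f y) / 2) => //; apply/nbhs_mdist.
  have [c c0 cP] := continuous_mdist continuous_f y D0.
  exists c => // z /cP yz _ _; have := metric_triangle (f x) (f z) (f y).
  by rewrite (metric_sym (f z)); lra.
exists s, d; split=> //; first by rewrite s0.
by move=> y /andP[sy ys]; exact: dP.
Qed.

Lemma open_map_uniform (K : set X) (e : R) : open_map f -> compact K -> 0 < e ->
  exists2 d : R, 0 < d & forall y, K y -> forall w, mdist (f y) w < d ->
    exists2 z, f z = w & mdist y z < e.
Proof.
move=> of_ cK e0; apply: compact_uniform cK _ _.
  by move=> c d y d0 dc H w yw; apply: H; exact: lt_le_trans dc.
have e2 : 0 < e / 2 by rewrite divr_gt0.
move=> x Kx; have := of_ _ (open_mball x (e / 2)).
move=> /open_mdist/(_ (f x))[|d d0 dP].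
  by exists x => //; rewrite mball mdistxx.
have d2 : 0 < d / 2 by rewrite divr_gt0.
have [c c0 cP] := continuous_mdist continuous_f x d2.
exists (d / 2) => //; apply/nbhs_mdist; exists (Num.min c (e / 2)).
  by rewrite lt_min c0.
move=> y; rewrite lt_min => /andP[/cP fxy xy] _ w fyw.
have [|z xz fz] := dP w.
  by have := metric_triangle (f x) (f y) w; lra.
exists z => //; move: xz; rewrite mball.
by have := metric_triangle y x z; rewrite (metric_sym y x); lra.
Qed.

Lemma path_uniform (g : R -> Y) (e : R) : is_path g -> 0 < e ->
  exists2 d : R, 0 < d & forall t, 0 <= t <= 1 -> forall s, 0 <= s <= 1 ->
    `|t - s| < d -> mdist (g t) (g s) < e.
Proof.
move=> /path_mdist gc e0; have e2 : 0 < e / 2 by rewrite divr_gt0.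
have [||d d0 dP] := @compact_uniform R R `[0, 1]%classic
    (fun d t => forall s, 0 <= s <= 1 -> `|t - s| < d -> mdist (g t) (g s) < e)
    (@segment_compact R 0 1).
- by move=> c d t d0 dc H s s01 ts; apply: H => //; exact: lt_le_trans dc.
- move=> t; rewrite /= in_itv/= => t01; have [d d0 dP] := gc t t01 _ e2.
  have d2 : 0 < d / 2 by rewrite divr_gt0.
  exists (d / 2) => //; apply/nbhs_ballP; exists (d / 2) => //= s ts.
  rewrite in_itv/= => s01 r r01 sr.
  have h1 : mdist (g t) (g s) < e / 2.
    by apply: dP => //; rewrite /ball/= in ts; lra.
  have h2 : mdist (g t) (g r) < e / 2.
    apply: dP => //; rewrite /ball/= in ts.
    by have := ler_distD s t r; lra.
  have := metric_triangle (g s) (g t) (g r).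
  by rewrite (metric_sym (g s) (g t)); lra.
by exists d => // t t01; apply: dP; rewrite /= in_itv.
Qed.

Section component_image.
Hypothesis path_metricX : path_metric_space X.
Hypothesis path_metricY : path_metric_space Y.

(** The image is nonempty, open, and closed relative to the ball, since the closure of the component
    has compact image; the ball of [Y] is connected. *)
Lemma component_image_ball (K : set X) (x : X) (y : Y) (r : R) : open_map f ->
  compact K -> connected_component (f @^-1` ball y r) x `<=` K ->
  mdist y (f x) < r ->
  f @` connected_component (f @^-1` ball y r) x = ball y r.
Proof.
move=> of_ cK VK yx; set V := connected_component _ _.
have oB : open (f @^-1` ball y r).
  by apply: open_comp => [z _|]; [exact: continuous_f|exact: open_mball].
have VB : f @` V `<=` ball y r.
  by move=> _ [z /connected_component_sub ? <-].
apply: (ball_connected path_metricY).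
- exists (f x); exists x => //; apply: connected_component_refl.
  by rewrite /preimage/= mball.
- exists (f @` V); last by apply/esym/setIidPr.
  exact/of_/(open_component path_metricX).
- exists (f @` closure V); last first.
    apply/seteqP; split=> [w Vw|w [+ [z clz fz]]].
      split; first exact: VB.
      by case: Vw => z /subset_closure ? <-; exists z.
    rewrite -fz => Bz; exists z => //.
    exact: (closure_component path_metricX).
  apply: compact_closed; first exact: metric_hausdorff.
  apply: continuous_compact; first exact: continuous_subspaceT.
  apply: (subclosed_compact _ cK); first exact: closed_closure.
  have /closure_id -> : closed K.
    exact: compact_closed (@metric_hausdorff _ _) cK.
  exact: closureS.
Qed.

Lemma coradial_locally_radial (L : R) : 1 <= L -> coradial L f ->
  forall x, locally_radial f L x.
Proof.
move=> L1 [[_ df of_] cf] x; have L0 : 0 < L by lra.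
have [r0 r00 rP] := cf x.
have [s [d [/andP[s0 _] d0 cK sinj sann]]] := @discrete_annulus x 1 df ltr01.
have s2 : 0 < s / 2 by rewrite divr_gt0.
have m0 : 0 < Num.min d r0 by rewrite lt_min d0.
have [c c0 cP] := continuous_mdist continuous_f x m0.
exists (Num.min c (s / 2)) => [|y]; first by rewrite lt_min c0.
rewrite lt_min => /andP[/cP + xy]; rewrite lt_min => /andP[fd fr0].
have := mdist_ge0 (f x) (f y); rewrite le_eqVlt => /predU1P[/esym r_eq0|].
  have -> : y = x.
    by apply: sinj; [lra|by rewrite (mdist_positivity _ _ r_eq0)].
  by rewrite !mdistxx mulr0.
set r := mdist (f x) (f y) in fd fr0 * => r_gt0.
(* The component around [z] cannot cross the annulus, because [r < d]. It is mapped onto the ball,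
   so it contains a preimage of [f x], which can only be [x]. *)
have inU z : mdist x z < s / 2 -> mdist (f x) (f z) < r ->
    ball_component x f r z.
  move=> xz fxz; apply: connected_component_sym.
  have Vs : connected_component (f @^-1` ball (f x) r) z `<=` ball x (s / 2).
    apply: (@connected_sub_ball _ _ _ x z) => //.
    - exact: component_connected.
    - by apply: connected_component_refl; rewrite /preimage/= mball.
    - move=> w /connected_component_sub; rewrite /preimage/= mball => fw xw.
      by have := sann w; rewrite xw lexx/= => /(_ ltac:(lra)); lra.
  have : (f @` connected_component (f @^-1` ball (f x) r) z) (f x).
    rewrite (component_image_ball of_ cK)// ?mball ?mdistxx//.
    by move=> w /Vs; rewrite mball/=; lra.
  move=> [w Vw fw]; suff wx : w = x by rewrite wx in Vw.
  by apply: sinj => //; have := Vs w Vw; rewrite mball; lra.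
have yU : boundary (ball_component x f r) y.
  split; last first.
    move=> /interior_subset/connected_component_sub.
    by rewrite /preimage/= mball ltxx.
  apply/closure_mdist => e e0.
  pose e' := Num.min e (s / 2 - mdist x y).
  have e'0 : 0 < e' by rewrite lt_min e0 subr_gt0.
  have /open_mdist/(_ (f y))[|h h0 hP] := of_ _ (open_mball y e').
    by exists y => //; rewrite mball mdistxx.
  (* A point [w] at distance [t < h] from [f y] and closer than [r - t / 2] to [f x] lifts to a
     point [z] near [y], and [inU] applies to [z]. *)
  pose t := Num.min (h / 2) r.
  have [t0 th tr] : [/\ 0 < t, t <= h / 2 & t <= r].
    by rewrite /t lt_min !ge_min !lexx orbT r_gt0 andbT divr_gt0.
  have t2 : 0 < t / 2 by rewrite divr_gt0.
  have [|w yw wx] := @path_metric_between _ _ path_metricY (f y) (f x) t _ _ t2.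
    by rewrite (metric_sym (f y)) (ltW t0).
  rewrite (metric_sym (f y) (f x)) -/r (metric_sym w) in wx.
  have [|z yz fz] := hP w; first lra.
  move: yz; rewrite mball lt_min => /andP[yz yz'].
  exists z => //; apply: inU; last by rewrite fz; lra.
  by have := metric_triangle x y z; lra.
have [|+ +] := rP r; first by rewrite r_gt0.
move=> /dist_sup_le H1 /le_dist_inf H2; split.
  by apply: H1; [rewrite mulr_ge0 ?ltW|exists y].
by rewrite -ler_pdivrMl//; apply: H2; exists y.
Qed.

End component_image.
End discrete_open.

(** * Ekeland's principle *)

Section ekeland.
Context {R : realType} {X : metricType R}.
Hypothesis completeX : complete_space X.

(** The relation [S] of the proof is an order along which [phi] decreases at least as much as the
    distance covered. A greedy [S]-chain is Cauchy, and its limit is maximal. *)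
Lemma ekeland (phi : X -> R) :
  (forall x (e : R), 0 < e -> exists2 d : R, 0 < d &
    forall y, mdist x y < d -> `|phi x - phi y| < e) ->
  (forall x, 0 <= phi x) ->
  forall x, exists2 y, mdist x y <= phi x - phi y &
    forall z, z <> y -> phi y - phi z < mdist y z.
Proof.
move=> phic phi0 x.
pose S y := [set z | mdist y z <= phi y - phi z].
have S_refl y : S y y by rewrite /S/= mdistxx subrr.
have S_trans y z w : S y z -> S z w -> S y w.
  by rewrite /S/= => yz zw; have := metric_triangle y z w; lra.
have S_le y z : S y z -> phi z <= phi y.
  by rewrite /S/= => yz; have := mdist_ge0 y z; lra.
(* Greedy choice: [phi z] is at most the mean of [phi y] and of the infimum of
   [phi] on [S y]. *)
have /choice[F FP] : forall y, exists z, S y z /\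
    forall w, S y w -> phi z - phi w <= phi y - phi z.
  move=> y; pose m := inf (phi @` S y).
  have infS : has_inf (phi @` S y).
    by split; [exists (phi y), y|exists 0 => _ [z _ <-]].
  have m_le w : S y w -> m <= phi w.
    by move=> Sw; apply: ge_inf; [case: infS|exists w].
  have [ym|] := ltP m (phi y); last first.
    move=> ym; exists y; split=> // w /m_le; lra.
  have ym2 : 0 < (phi y - m) / 2 by rewrite divr_gt0// subr_gt0.
  have [_ [z Sz <-] zm] := inf_adherent ym2 infS.
  by exists z; split=> // w /m_le; rewrite -/m in zm; lra.
pose u n := iter n F x.
have uS n k : S (u n) (u (n + k)%N).
  elim: k => [|k ih]; first by rewrite addn0.
  by rewrite addnS; apply: S_trans ih _; case: (FP (u (n + k)%N)).
have {}uS m n : (m <= n)%N -> S (u m) (u n) by move=> /subnKC <-.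
pose l := inf (range (phi \o u)).
have infu : has_inf (range (phi \o u)).
  by split; [exists (phi x), 0%N|exists 0 => _ [n _ <-]; exact: phi0].
have l_le n : l <= phi (u n) by apply: ge_inf; [case: infu|exists n].
have small e : 0 < e -> exists N, phi (u N) < l + e.
  by move=> e0; have [_ [n _ <-] ne] := inf_adherent e0 infu; exists n.
have /completeX[y uy] : cauchy (u @ \oo).
  apply: cauchy_exP => e e0; have [N Ne] := small e e0.
  exists (u N); exists N => // n /= /uS; rewrite mball /S/=.
  by have := l_le n; lra.
have Sy n : S (u n) y.
  rewrite /S/=; apply/ler_addgt0Pl => e e0.
  have e2 : 0 < e / 2 by rewrite divr_gt0.
  have [d d0 dP] := phic y _ e2.
  have /uy[N _ NP] : nbhs y [set z | mdist y z < Num.min d (e / 2)].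
    by apply/nbhs_mdist; exists (Num.min d (e / 2)); rewrite // lt_min d0.
  have := NP (maxn N n) (leq_maxl _ _); rewrite /= lt_min => /andP[/dP h1 h2].
  have := uS n (maxn N n) (leq_maxr _ _); rewrite /S/=.
  have := metric_triangle (u n) (u (maxn N n)) y.
  rewrite (metric_sym (u (maxn N n)) y); move: h1; rewrite ltr_norml => /andP[].
  by lra.
exists y => [|z zy]; first exact: (Sy 0%N).
rewrite ltNge; apply/negP => Syz; apply: zy.
(* Since [z] competes in every greedy choice, it lies below [phi (u N.+1)] by at most the drop from
   [phi (u N)] to [phi (u N.+1)], which tends to [0]. *)
have le_phi : phi y <= phi z.
  apply/ler_addgt0Pl => e e0; have [N Ne] := small e e0.
  have [_ /(_ z (S_trans _ _ _ (Sy N) Syz))] := FP (u N).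
  have := l_le N.+1; have := S_le _ _ (Sy N.+1).
  by rewrite /u /= -/(u N); lra.
apply/esym/(mdist_positivity y z)/eqP; rewrite eq_le mdist_ge0 andbT.
by apply: le_trans Syz _; rewrite subr_le0.
Qed.

End ekeland.

(** * Path lifting *)

Section lifting.
Context {R : realType} {X Y : metricType R} (f : X -> Y).
Hypothesis continuous_f : continuous f.
Hypothesis open_f : open_map f.

(** Uniform openness lifts one grid value after another. Steps shorter than [s / 2] cannot jump over
    the annulus, and landing in it is excluded by [bd], so the lift stays in the half ball. The
    bound [e] controls both the mesh and the steps. *)
Lemma grid_lift (x : X) (s d e : R) (b : R -> Y) :
  0 < s -> compact [set y | mdist x y <= s] ->
  (forall y, s / 2 <= mdist x y <= s -> d <= mdist (f x) (f y)) ->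
  is_path b -> b 0 = f x -> (forall t, 0 <= t <= 1 -> mdist (f x) (b t) < d) ->
  0 < e ->
  exists n (u : nat -> X), [/\ n.+1%:R^-1 < e, u 0%N = x,
    forall i, (i <= n.+1)%N -> f (u i) = b (i%:R / n.+1%:R) /\
                               mdist x (u i) < s / 2 &
    forall i, (i < n.+1)%N -> mdist (u i) (u i.+1) < e].
Proof.
move=> s0 cK ann bc b0 bd e0.
have e'0 : 0 < Num.min e (s / 2) by rewrite lt_min e0 divr_gt0.
have [h h0 hP] := open_map_uniform continuous_f open_f cK e'0.
have [c c0 cP] := path_uniform bc h0.
have ce0 : 0 < Num.min c e by rewrite lt_min c0.
have [n] := ltr_add_invr ce0; rewrite add0r lt_min => /andP[nc ne].
have n0 : 0 < n.+1%:R :> R by rewrite ltr0n.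
have in01 i : (i <= n.+1)%N -> 0 <= (i%:R / n.+1%:R : R) <= 1.
  by move=> le_in; rewrite divr_ge0//= ler_pdivrMr// mul1r ler_nat.
(* The step function is total, with premises guarding its properties, so that it can be iterated by
   [iteri]. *)
have /choice[F FP] : forall p : nat * X, exists z,
    (p.1 < n.+1)%N -> f p.2 = b (p.1%:R / n.+1%:R) -> mdist x p.2 < s / 2 ->
    [/\ f z = b (p.1.+1%:R / n.+1%:R), mdist x z < s / 2 & mdist p.2 z < e].
  move=> [i y] /=.
  have [[ni fy xy]|H] := pselect [/\ (i < n.+1)%N,
      f y = b (i%:R / n.+1%:R) & mdist x y < s / 2]; last first.
    by exists y => ? ? ?; case: H.
  have [||z fz] := hP y _ (b (i.+1%:R / n.+1%:R)).
  - by rewrite /=; lra.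
  - rewrite fy; apply: cP; [exact/in01/ltnW|exact: in01|].
    rewrite -mulrBl -natr1 opprD addNKr mulN1r normrN.
    by rewrite ger0_norm// invr_ge0 ltW.
  rewrite lt_min => /andP[yz yz'].
  exists z => _ _ _; split=> //.
  have := metric_triangle x y z => xyz.
  rewrite ltNge; apply/negP => xz.
  have := ann z; rewrite xz/= => /(_ ltac:(lra)); rewrite fz leNgt.
  by rewrite bd// in01.
exists n, (fun i => iteri i (fun j y => F (j, y)) x).
have uP i : (i <= n.+1)%N ->
    let u := iteri i (fun j y => F (j, y)) x in
    f u = b (i%:R / n.+1%:R) /\ mdist x u < s / 2.
  elim: i => [_|i ih ni] /=; first by rewrite mul0r mdistxx divr_gt0.
  have [fu xu] := ih (ltnW ni).
  by have [] := FP (i, iteri i (fun j y => F (j, y)) x) ni fu xu.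
split=> // i ni.
have [fu xu] := uP i (ltnW ni).
by have [] := FP (i, iteri i (fun j y => F (j, y)) x) ni fu xu.
Qed.

(* Between grid points whose images stay closer than [d] to [f a], a chain of
   steps shorter than [s / 2] cannot cross the annulus around [a]. *)
Lemma chain_in_ball (a : X) (s d : R) (u : nat -> X) (i j : nat) :
  (forall y, s / 2 <= mdist a y <= s -> d <= mdist (f a) (f y)) ->
  (i <= j)%N ->
  (forall m, (i <= m <= j)%N -> mdist (f a) (f (u m)) < d) ->
  (forall m, (i <= m < j)%N -> mdist (u m) (u m.+1) < s / 2) ->
  mdist a (u i) < s / 2 <-> mdist a (u j) < s / 2.
Proof.
move=> ann ij; rewrite -(subnKC ij).
elim: (j - i)%N => [|k ih] fu uu; first by rewrite addn0.
rewrite addnS; rewrite addnS in fu uu.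
have {ih}-> : mdist a (u i) < s / 2 <-> mdist a (u (i + k)%N) < s / 2.
  by apply: ih => m /andP[im mk]; [apply: fu|apply: uu]; rewrite im ltnW.
have step : mdist (u (i + k)%N) (u (i + k).+1) < s / 2.
  by apply: uu; rewrite leq_addr/=.
have away m : (i <= m <= (i + k).+1)%N ->
    mdist a (u m) < s -> mdist a (u m) < s / 2.
  move=> /fu fum ams; rewrite ltNge; apply/negP => sm.
  by have := ann (u m); rewrite sm ltW//= => /(_ isT); rewrite leNgt fum.
have h1 := metric_triangle a (u (i + k)%N) (u (i + k).+1).
have h2 := metric_triangle a (u (i + k).+1) (u (i + k)%N).
rewrite (metric_sym (u (i + k).+1)) in h2.
split=> H; apply: away; rewrite ?leqnn ?leqnSn ?leq_addr//; last lra.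
- by rewrite (leq_trans (leq_addr _ _) (leqnSn _)).
- lra.
Qed.

(** Compactness gives a cluster point [p]; an ultrafilter contains each set or its complement, and
    clustering rules out the complement of a ball around [p]. *)
Lemma ultra_compact_cvg (U : set_system nat) (K : set X) (v : nat -> X) :
  UltraFilter U -> compact K -> (forall k, K (v k)) ->
  exists2 p, K p & forall e : R, 0 < e -> U [set k | mdist p (v k) < e].
Proof.
move=> UU cK Kv.
have [|p [Kp clp]] := cK (v @ U) _.
  by apply: (@filterS _ U _ setT) => [k _|]; [exact: Kv|exact: filterT].
exists p => // e e0.
have [//|Uc] := in_ultra_setVsetC [set k | mdist p (v k) < e] UU.
have [||w [/= wp pw]] := clp [set w | ~ mdist p w < e] [set w | mdist p w < e].
- exact: Uc.
- by apply/nbhs_mdist; exists e.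
- by [].
Qed.

End lifting.

Section path_lifting.
Context {R : realType} {X Y : metricType R} (f : X -> Y).
Hypothesis continuous_f : continuous f.
Hypothesis locally_compactX : locally_compact [set: X].
Hypothesis discrete_f : discrete_map f.
Hypothesis open_f : open_map f.

Lemma truncn_grid (n : nat) (t : R) : 0 <= t <= 1 ->
  (Num.truncn (t * n.+1%:R) <= n.+1)%N /\
  `|t - (Num.truncn (t * n.+1%:R))%:R / n.+1%:R| < n.+1%:R^-1.
Proof.
move=> /andP[t0 t1]; have n0 : 0 < n.+1%:R :> R by rewrite ltr0n.
have tn0 : 0 <= t * n.+1%:R by rewrite mulr_ge0// ltW.
have /andP[le_tn tn_lt] := truncn_itv tn0.
split.
  by rewrite -(ler_nat R) (le_trans le_tn)// ler_piMl// ltW.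
rewrite ger0_norm ?subr_ge0 ?ler_pdivrMr//.
by rewrite ltrBlDl -[X in _ + X]mul1r -mulrDl ltr_pdivlMr// natr1.
Qed.

(* The lift is the limit, along an ultrafilter, of lifts of ever finer grids;
   it is continuous because the grid lifts cannot cross small annuli around its
   values. *)
Lemma path_lift (x : X) : exists2 d : R, 0 < d & forall b : R -> Y,
  is_path b -> b 0 = f x -> (forall t, 0 <= t <= 1 -> mdist (f x) (b t) < d) ->
  exists g : R -> X, [/\ is_path g, g 0 = x &
    forall t, 0 <= t <= 1 -> f (g t) = b t].
Proof.
have [s [d [/andP[s0 _] d0 cK _ ann]]] :=
  discrete_annulus continuous_f locally_compactX x discrete_f ltr01.
exists d => // b bc b0 bd.
have /choice[nu nuP] : forall k : nat, exists p : nat * (nat -> X),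
    [/\ p.1.+1%:R^-1 < (k.+1%:R^-1 : R), p.2 0%N = x,
    forall i, (i <= p.1.+1)%N -> f (p.2 i) = b (i%:R / p.1.+1%:R) /\
                               mdist x (p.2 i) < s / 2 &
    forall i, (i < p.1.+1)%N -> mdist (p.2 i) (p.2 i.+1) < k.+1%:R^-1].
  move=> k; have k0 : 0 < k.+1%:R^-1 :> R by rewrite invr_gt0 ltr0n.
  have [n [u uP]] := grid_lift continuous_f open_f s0 cK ann bc b0 bd k0.
  by exists (n, u).
pose n k := (nu k).1; pose u k := (nu k).2.
pose tr k (t : R) := Num.truncn (t * (n k).+1%:R).
have u0 k : u k 0%N = x by case: (nuP k).
have uf k i : (i <= (n k).+1)%N -> f (u k i) = b (i%:R / (n k).+1%:R).
  by move=> ik; have [_ _ /(_ i ik)[]] := nuP k.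
have us k i : (i <= (n k).+1)%N -> mdist x (u k i) < s / 2.
  by move=> ik; have [_ _ /(_ i ik)[]] := nuP k.
(* One ultrafilter serves all [t] at once, so no diagonal extraction of subsequences is needed. *)
have [U [UU infU]] := ultraFilterLemma (@eventually_filter).
have small (e : R) : 0 < e -> U [set k | k.+1%:R^-1 < e].
  move=> e0; apply: infU; exact: near_infty_natSinv_lt (PosNum e0).
have /choice[g gP] : forall t : R, exists p, 0 <= t <= 1 ->
    forall e : R, 0 < e -> U [set k | mdist p (u k (tr k t)) < e].
  move=> t; have [t01|_] := boolP (0 <= t <= 1); last by exists x.
  have [k|p _ pP] := ultra_compact_cvg (v := fun k => u k (tr k t)) UU cK.
    have /= := us k (tr k t) (truncn_grid (n k) t01).1; lra.
  by exists p.
have trP k t : 0 <= t <= 1 -> (tr k t <= (n k).+1)%N /\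
    `|t - (tr k t)%:R / (n k).+1%:R| < (n k).+1%:R^-1.
  exact: truncn_grid.
have in01 k i : (i <= (n k).+1)%N -> 0 <= (i%:R / (n k).+1%:R : R) <= 1.
  by move=> le_in; rewrite divr_ge0//= ler_pdivrMr ?ltr0n// mul1r ler_nat.
have gf t : 0 <= t <= 1 -> f (g t) = b t.
  move=> t01; apply: mdist_positivity; apply/eqP.
  rewrite eq_le mdist_ge0 andbT; apply/ler_addgt0Pl => e e0; rewrite addr0.
  have e2 : 0 < e / 2 by rewrite divr_gt0.
  have [c c0 cP] := continuous_mdist continuous_f (g t) e2.
  have [h h0 hP] := (path_mdist b).1 bc t t01 _ e2.
  have [k [/= /cP gk kh]] := filter_ex (filterI (gP t t01 c c0) (small h h0)).
  have [tr_le tr_t] := trP k t t01.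
  have [nk _ _ _] := nuP k; rewrite -/(n k) in nk.
  have := hP _ (in01 k _ tr_le) (lt_trans (lt_trans tr_t nk) kh).
  move: gk; rewrite (uf k _ tr_le) => h1.
  rewrite (metric_sym (b t)) => h2.
  have := metric_triangle (f (g t)) (b ((tr k t)%:R / (n k).+1%:R)) (b t).
  by lra.
have g0 : g 0 = x.
  apply: mdist_positivity; apply/eqP; rewrite eq_le mdist_ge0 andbT.
  apply/ler_addgt0Pl => e e0; rewrite addr0.
  have [|k /=] := filter_ex (gP 0 _ e e0); first by rewrite lexx ler01.
  by rewrite /tr mul0r truncn0 u0 => /ltW.
exists g; split=> //; apply/path_mdist => t t01 e e0.
have [r [q [/andP[r0 re] q0 _ _ annq]]] :=
  discrete_annulus continuous_f locally_compactX (g t) discrete_f e0.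
have r2 : 0 < r / 2 by rewrite divr_gt0.
have [h h0 hP] := (path_mdist b).1 bc t t01 _ q0.
(* Half of [h] is kept for the mesh, so that the grid point below [t'] is still within [h] of
   [t]. *)
exists (h / 2); first by rewrite divr_gt0.
move=> t' t'01 tt'.
have m0 : 0 < Num.min (h / 2) (r / 2) by rewrite lt_min r2 divr_gt0.
have [k [[/= kt kt'] km]] :=
  filter_ex (filterI (filterI (gP t t01 _ r2) (gP t' t'01 _ r2)) (small _ m0)).
move: km; rewrite /= lt_min => /andP[kh kr].
have [tr_le tr_t] := trP k t t01.
have [tr_le' tr_t'] := trP k t' t'01.
have [nk _ _ step] := nuP k; rewrite -/(n k) -/(u k) in nk step.
have near_t : `|t - (tr k t)%:R / (n k).+1%:R| < h.
  by rewrite (lt_trans tr_t)// (lt_trans nk)// (lt_trans kh)// gtr_pMr//; lra.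
have near_t' : `|t - (tr k t')%:R / (n k).+1%:R| < h.
  rewrite (le_lt_trans (ler_distD t' _ _))// (splitr h) ltrD//.
  by rewrite (lt_trans tr_t')// (lt_trans nk).
(* All grid points between two that are within [h] of [t] are also within [h] of [t], so their
   [b]-values stay within [q] of [f (g t)], as [chain_in_ball] requires. *)
have chain i j : (i <= j)%N -> (j <= (n k).+1)%N ->
    `|t - i%:R / (n k).+1%:R| < h -> `|t - j%:R / (n k).+1%:R| < h ->
    mdist (g t) (u k i) < r / 2 <-> mdist (g t) (u k j) < r / 2.
  move=> ij jn ti tj; apply: (chain_in_ball annq) => // m /andP[im mj].
    have mn := leq_trans mj jn; rewrite (uf k m mn) gf//; apply: hP.
      exact: in01.
    have lei : i%:R / (n k).+1%:R <= m%:R / (n k).+1%:R :> R.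
      by rewrite ler_pM2r ?invr_gt0 ?ltr0n// ler_nat.
    have lej : m%:R / (n k).+1%:R <= j%:R / (n k).+1%:R :> R.
      by rewrite ler_pM2r ?invr_gt0 ?ltr0n// ler_nat.
    move: lei lej ti tj; rewrite !ltr_norml.
    move: (_ / _) (_ / _) (_ / _) => p1 p2 p3.
    by move=> ? ? /andP[? ?] /andP[? ?]; apply/andP; split; lra.
  exact: lt_trans (step m (leq_trans mj jn)) kr.
have : mdist (g t) (u k (tr k t')) < r / 2.
  have [tt|tt] := leqP (tr k t) (tr k t').
    exact/(chain _ _ tt tr_le' near_t near_t').
  exact/(chain _ _ (ltnW tt) tr_le near_t' near_t).
have := metric_triangle (g t) (u k (tr k t')) (g t').
by rewrite (metric_sym (u k (tr k t')) (g t')); lra.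
Qed.

End path_lifting.

(** * BLD-mappings are Lipschitz quotients *)

Section BLD_lipschitz_quotient.
Context {R : realType} {X Y : metricType R} (f : X -> Y) (L : R).
Hypothesis L_ge1 : 1 <= L.
Hypothesis completeX : complete_space X.
Hypothesis locally_compactX : locally_compact [set: X].
Hypothesis path_metricX : path_metric_space X.
Hypothesis path_metricY : path_metric_space Y.

Let L_gt0 : 0 < L. Proof. exact: lt_le_trans L_ge1. Qed.

Lemma BLD_lipschitz (x y : X) (r : R) : BLD L f ->
  mdist x y < r -> mdist (f x) (f y) < L * r.
Proof.
move=> [_ bf] /(path_metric_path path_metricX)[g [gc g0 g1 gr]].
have := mdist_le_length (f \o g).
rewrite /= g0 g1 -lte_fin => /le_lt_trans; apply.
have /andP[_ /le_lt_trans] := bf g gc; apply.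
by rewrite EFinM lte_pmul2l// lte_fin.
Qed.

(** A path from [f x] to [w] of length less than [c] stays within [d] of [f x], hence lifts by
    [path_lift]; the lower BLD bound makes the lift shorter than [L * c]. *)
Lemma BLD_local_colipschitz (x : X) : BLD L f ->
  exists2 d : R, 0 < d & forall w c, mdist (f x) w < c -> c <= d ->
    exists2 z, f z = w & mdist x z < L * c.
Proof.
move=> [[cf df of_] bf].
have [d d0 lift] := path_lift cf locally_compactX df of_ x.
exists d => // w c /(path_metric_path path_metricY)[b [bc b0 b1 bl]] cd.
have [||g [gc g0 gb]] := lift b bc _ _ => //.
  move=> t t01; have := le_lt_trans (length_split b t01) bl.
  by rewrite lte_fin b0; have := mdist_ge0 (b t) (b 1); lra.
exists (g 1); first by rewrite gb ?b1// ler01 lexx.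
have := mdist_le_length g; rewrite g0 -lte_fin => /le_lt_trans; apply.
have /andP[+ _] := bf g gc; rewrite lee_pdivrMl// => /le_lt_trans; apply.
by rewrite EFinM lte_pmul2l ?lte_fin// (@eq_length _ _ _ b).
Qed.

(* Apply Ekeland's principle to [L' * mdist (f y) z] with [L'] slightly larger
   than [L]: where [f y <> z], a point of [Y] slightly closer to [z] than [f y]
   has a preimage that contradicts the minimality of [y]. *)
Lemma BLD_colipschitz (x : X) (z : Y) (r : R) : BLD L f ->
  L * mdist (f x) z < r -> exists2 y, f y = z & mdist x y < r.
Proof.
move=> bldf xz; have [[cf _ _] _] := bldf.
have D0 := mdist_ge0 (f x) z.
(* This choice makes [(L + k) * mdist (f x) z < r]; the [+ 1] covers the case [f x = z]. *)
pose k := (r - L * mdist (f x) z) / (mdist (f x) z + 1).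
have k0 : 0 < k by rewrite divr_gt0 ?subr_gt0// ltr_wpDl.
have kD : k * mdist (f x) z < r - L * mdist (f x) z.
  rewrite /k mulrAC -mulrA gtr_pMr ?subr_gt0//.
  by rewrite ltr_pdivrMr ?mul1r ?ltrDl// ltr_wpDl.
have M0 : 0 < L + k by rewrite addr_gt0.
pose phi y := (L + k) * mdist (f y) z.
have [||y xy ymin] := @ekeland _ _ completeX phi _ _ x.
- move=> y e e0; have eM : 0 < e / (L + k) by rewrite divr_gt0.
  have [d d0 dP] := continuous_mdist cf y eM.
  exists d => // w /dP yw; rewrite /phi -mulrBr normrM gtr0_norm//.
  rewrite mulrC -ltr_pdivlMr//; apply: le_lt_trans yw.
  have := metric_triangle (f y) (f w) z; have := metric_triangle (f w) (f y) z.
  by rewrite (metric_sym (f w) (f y)) ler_norml => ? ?; apply/andP; split; lra.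
- by move=> y; rewrite mulr_ge0 ?mdist_ge0// ltW.
exists y; last first.
  apply: le_lt_trans xy _; rewrite /phi.
  have : 0 <= (L + k) * mdist (f y) z by rewrite mulr_ge0 ?mdist_ge0// ltW.
  by rewrite mulrDl; lra.
apply: contrapT => /eqP; rewrite -mdist_gt0 => fyz.
have [d d0 dP] := BLD_local_colipschitz y bldf.
pose s := Num.min (d / 2) (mdist (f y) z).
have [s0 sd sy] : [/\ 0 < s, s <= d / 2 & s <= mdist (f y) z].
  by rewrite /s lt_min !ge_min !lexx orbT fyz andbT divr_gt0.
have Lk : 0 < L + L + k by rewrite -addrA addr_gt0.
(* This [e] solves [(L + k) * (s - e) = L * (s + e)]: the gain in [phi] from moving to the preimage
   [y'] of [w] then exceeds the bound [L * (s + e)] on [mdist y y']. *)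
pose e := s * k / (L + L + k).
have e0 : 0 < e by rewrite divr_gt0// mulr_gt0.
have eE : e * (L + L + k) = s * k by rewrite /e divfK// gt_eqF.
have es : e <= s.
  rewrite /e -mulrA ger_pMr// ler_pdivrMr// mul1r lerDr.
  by rewrite addr_ge0// ltW.
have [|w yw wz] :=
    path_metric_between path_metricY (x := f y) (y := z) (s := s) _ e0.
  by rewrite (ltW s0).
have [||y' fy' yy'] := dP w (s + e).
- by rewrite yw ltrDl.
- by rewrite (splitr d) lerD// (le_trans es).
have := ymin y'; rewrite /phi fy' => H.
have {}H : (L + k) * mdist (f y) z - (L + k) * mdist w z < mdist y y'.
  apply: H => y'y; move: s0.
  by rewrite -yw -fy' y'y mdistxx ltxx.
have : (L + k) * (s - e) < (L + k) * (mdist (f y) z - mdist w z).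
  by rewrite ltr_pM2l//; lra.
by nra.
Qed.

Lemma BLD_lipschitz_quotient : BLD L f -> lipschitz_quotient L f.
Proof.
move=> bldf x r r0; split=> [z|_ [y + <-]]; rewrite !mball; last first.
  exact: BLD_lipschitz.
rewrite mulrC ltr_pdivlMr// mulrC => /(BLD_colipschitz bldf)[y fy xy].
by exists y => //; rewrite mball.
Qed.

End BLD_lipschitz_quotient.

Theorem theorem1p1 (R : realType) (X Y : metricType R)
    (completeX : complete_space X) (completeY : complete_space Y)
    (locally_compactX : locally_compact [set: X])
    (locally_compactY : locally_compact [set: Y])
    (path_metricX : path_metric_space X)
    (path_metricY : path_metric_space Y)
    (f : X -> Y) (continuous_f : continuous f) (L : R) (L_ge1 : 1 <= L) :
  [<-> BLD L f;
       discrete_map f /\ lipschitz_quotient L f;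
       open_map f /\ radial L f;
       coradial L f].
Proof.
tfae.
- move=> bldf; split; first by case: bldf => -[].
  exact: BLD_lipschitz_quotient.
- move=> [df lqf]; split; first exact: (lipschitz_quotient_open L_ge1 lqf).
  exact: lipschitz_quotient_radial.
- move=> [of_ rf]; apply: locally_radial_coradial => //.
  exact: radial_locally_radial.
- move=> cof; apply: locally_radial_BLD => //; first by case: cof.
  exact: coradial_locally_radial.
Qed.
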